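(* Let $L/K$ be an extension of real-valued fields such that $K$ is dense in $L$, and let $A\to K$ be a homomorphism of rings. Then the completion $\widehat{\psi}_{L/K/A}$ of the natural map $\psi_{L/K/A}:\Omega_{K/A}\otimes_KL\to\Omega_{L/A}$ is an isometric isomorphism. In particular, $\widehat{\Omega}_{K/A}\xrightarrow{\ \sim\ }\widehat{\Omega}_{L/A}$.
   Context: A real-valued field is a field with a non-archimedean valuation with values in $\mathbb{R}_{\ge 0}$ (possibly trivial, not necessarily complete); in an extension $L/K$ of real-valued fields the valuation of $L$ extends that of $K$. For a homomorphism of rings $A\to K$ to a real-valued field, the Kähler seminorm on $\Omega_{K/A}$ is $\|x\|_\Omega=\inf\max_i|c_i|\,|b_i|$, the infimum being over all finite representations $x=\sum_i c_i\,d(b_i)$ with $c_i,b_i\in K$; similarly for $\Omega_{L/A}$. The space $\Omega_{K/A}\otimes_KL$ has the tensor seminorm $\|z\|=\inf\max_i\|m_i\|_\Omega\,|a_i|$ over all finite representations $z=\sum_i m_i\otimes a_i$. Completion means separated (Hausdorff) completion with respect to the seminorm, and $\widehat{\Omega}_{K/A}$, $\widehat{\Omega}_{L/A}$ denote the completions of $\Omega_{K/A}$, $\Omega_{L/A}$ with respect to the Kähler seminorms. *)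

(* Defs.v *)
From HB Require Import structures.
From mathcomp Require Import all_boot all_order all_algebra.
From mathcomp Require Import boolp classical_sets functions reals.
From mathcomp Require Import topology normedtype sequences.
From mathcomp.multinomials Require Import freeg.

Set Implicit Arguments.
Unset Strict Implicit.
Unset Printing Implicit Defensive.

Import Order.TTheory GRing.Theory Num.Theory.
Import numFieldNormedType.Exports.

Local Open Scope classical_set_scope.
Local Open Scope quotient_scope.
Local Open Scope ring_scope.

(* Valuations are written multiplicatively, with values in the nonnegative
   reals. No completeness is assumed and the trivial valuation is allowed. *)
Record valuation (R : realType) (K : fieldType) := Valuation {
  vfun :> K -> R;
  v_ge0 : forall x, 0 <= vfun x;
  v_eq0 : forall x, vfun x = 0 <-> x = 0;
  vM : forall x y, vfun (x * y) = vfun x * vfun y;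
  vD : forall x y, vfun (x + y) <= Num.max (vfun x) (vfun y) }.

Record seminorm (R : realType) (F : fieldType) (v : valuation R F)
    (V : lmodType F) := Seminorm {
  snfun :> V -> R;
  sn_ge0 : forall x, 0 <= snfun x;
  snZ : forall a x, snfun (a *: x) = v a * snfun x;
  snD : forall x y, snfun (x + y) <= Num.max (snfun x) (snfun y) }.

Section ValuationTheory.
Variables (R : realType) (F : fieldType) (v : valuation R F).

Lemma v0 : v 0 = 0. Proof. exact/v_eq0. Qed.

Lemma v_gt0 a : a != 0 -> 0 < v a.
Proof. by move=> a0; rewrite lt0r v_ge0 andbT; apply: contra_neq a0 => /v_eq0. Qed.

Lemma v1 : v 1 = 1.
Proof.
have v1n0 : v 1 != 0 by rewrite gt_eqF // v_gt0 // oner_neq0.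
by apply: (mulfI v1n0); rewrite -vM !mulr1.
Qed.

Lemma vV a : a != 0 -> v a^-1 = (v a)^-1.
Proof.
move=> a0; have va0 : v a != 0 by rewrite gt_eqF // v_gt0.
by apply: (mulfI va0); rewrite -vM !divff ?v1.
Qed.

Variables (V : lmodType F) (p : seminorm v V).

Lemma sn0 : p 0 = 0.
Proof. by rewrite -(scale0r 0) snZ v0 mul0r. Qed.

Lemma snN x : p (- x) = p x.
Proof.
have vN1 : v (-1) = 1.
  apply/eqP; rewrite -(@eqrXn2 _ 2) ?v_ge0 ?ler01 //.
  by rewrite expr2 -vM mulrNN mulr1 v1 expr1n.
by rewrite -scaleN1r snZ vN1 mul1r.
Qed.

Lemma sn_sum (I : Type) (s : seq I) (f : I -> V) :
  p (\sum_(i <- s) f i) <= \big[Num.max/0]_(i <- s) p (f i).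
Proof.
elim: s => [|i s IH]; first by rewrite !big_nil sn0.
rewrite !big_cons (le_trans (snD _ _ _)) //.
by rewrite ge_max le_max lexx /= le_max IH orbT.
Qed.

End ValuationTheory.

Section QuotientModule.
Variables (F : nzRingType) (V : lmodType F).
Variables (S : {pred V}) (submodS : submod_closed S).

Definition quotmod_zmodClosed : zmodClosed V := HB.pack S
  (GRing.isZmodClosed.Build V S (GRing.submod_closedB submodS)).

Definition quotmod := Quotient.quot quotmod_zmodClosed.
HB.instance Definition _ := GRing.Zmodule.on quotmod.
HB.instance Definition _ := EqQuotient.on quotmod.

Definition quotmod_pi (x : V) : quotmod :=
  \pi_(Quotient.quot quotmod_zmodClosed) x.

Lemma quotmod_reprK (x : quotmod) : quotmod_pi (repr x) = x.
Proof. exact: reprK. Qed.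

Lemma quotmod_eqP (x y : V) : quotmod_pi x = quotmod_pi y <-> x - y \in S.
Proof.
split; first by move/eqP; rewrite /quotmod_pi -Quotient.idealrBE.
by move=> h; apply/eqP; rewrite /quotmod_pi -Quotient.idealrBE.
Qed.

Definition quotmod_scale (a : F) (x : quotmod) : quotmod :=
  quotmod_pi (a *: repr x).

Fact quotmod_piD : {morph quotmod_pi : x y / x + y}.
Proof. exact: (Quotient.pi_add quotmod_zmodClosed). Qed.

Fact quotmod_piZ a (x : V) :
  quotmod_pi (a *: x) = quotmod_scale a (quotmod_pi x).
Proof.
apply/quotmod_eqP; rewrite -scalerBr -[_ *: _]addr0.
have [S0 Slin] := submodS; apply: Slin => //.
by apply/quotmod_eqP; rewrite quotmod_reprK.
Qed.

Fact quotmod_scalerA a b x :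
  quotmod_scale a (quotmod_scale b x) = quotmod_scale (a * b) x.
Proof.
by rewrite -(quotmod_reprK x); move: (repr x) => y; rewrite -!quotmod_piZ scalerA.
Qed.

Fact quotmod_scale1r : left_id 1 quotmod_scale.
Proof.
by move=> x; rewrite -(quotmod_reprK x) -quotmod_piZ scale1r.
Qed.

Fact quotmod_scalerDr : right_distributive quotmod_scale +%R.
Proof.
move=> a x y; rewrite -(quotmod_reprK x) -(quotmod_reprK y).
move: (repr x) (repr y) => {}x {}y.
by rewrite -quotmod_piD -!quotmod_piZ -quotmod_piD scalerDr.
Qed.

Fact quotmod_scalerDl x : {morph quotmod_scale^~ x : a b / a + b}.
Proof.
move=> a b /=; rewrite -(quotmod_reprK x); move: (repr x) => {}x.
by rewrite -!quotmod_piZ -quotmod_piD scalerDl.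
Qed.

HB.instance Definition _ := GRing.Zmodule_isLmodule.Build F quotmod
  quotmod_scalerA quotmod_scale1r quotmod_scalerDr quotmod_scalerDl.

Fact quotmod_pi_linear : linear quotmod_pi.
Proof. by move=> a x y; rewrite quotmod_piD quotmod_piZ. Qed.
HB.instance Definition _ := GRing.isLinear.Build F V quotmod *:%R
  quotmod_pi quotmod_pi_linear.

End QuotientModule.

Section Span.
Variables (F : nzRingType) (V : lmodType F) (S : set V).

Definition span : {pred V} := fun x =>
  `[< exists s : seq (F * V),
      (forall q, q \in s -> S q.2) /\ x = \sum_(q <- s) q.1 *: q.2 >].

Fact span_submod_closed : submod_closed span.
Proof.
split; first by apply/asboolP; exists [::]; rewrite big_nil.
move=> a x y /asboolP[s [sS ->]] /asboolP[t [tS ->]]; apply/asboolP.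
exists ([seq (a * q.1, q.2) | q <- s] ++ t); split.
  by move=> q; rewrite mem_cat => /orP[/mapP[r rs ->]|/tS //]; exact: (sS r rs).
rewrite big_cat big_map scaler_sumr /=; congr (_ + _).
by apply: eq_bigr => q _; rewrite scalerA.
Qed.

End Span.

(* The left module with generators [gen g], g in G, and relations [r = 0],
   r in rels. *)
Section Presentation.
Variables (F : fieldType) (G : choiceType) (rels : set {freeg G / F}).

Definition presmod := quotmod (span_submod_closed rels).
HB.instance Definition _ := GRing.Lmodule.on presmod.

Local Notation pi := (quotmod_pi (span_submod_closed rels)).

Definition gen (g : G) : presmod := pi << g >>.

Lemma presmod_rel (x y : {freeg G / F}) : rels (x - y) -> pi x = pi y.
Proof.
move=> rxy; apply/quotmod_eqP/asboolP; exists [:: (1, x - y)]; split.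
  by move=> q; rewrite inE => /eqP ->.
by rewrite big_seq1 scale1r.
Qed.

Lemma presmod_span (x : presmod) :
  exists s : seq (F * G), x = \sum_(q <- s) q.1 *: gen q.2.
Proof.
rewrite -(quotmod_reprK x); set D := repr x.
exists [seq (coeff g D, g) | g <- dom D].
rewrite -[in LHS](freeg_sumE D) raddf_sum [RHS]big_map.
apply: eq_bigr => g _ /=; rewrite /gen -linearZ.
congr (quotmod_pi _ _); apply/eqP/freeg_eqP => h.
by rewrite coeffZ !coeffU mul1r.
Qed.

Section Lift.
Variables (M : lmodType F) (f : G -> M).

Fact fglift_zmod_morphism : zmod_morphism (fglift f : {freeg G / F} -> M).
Proof. exact: lift_is_additive. Qed.
HB.instance Definition _ := GRing.isZmodMorphism.Build {freeg G / F} M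
  (fglift f) fglift_zmod_morphism.

Fact fglift_scalable : scalable (fglift f : {freeg G / F} -> M).
Proof.
move=> c x; have -> : c *: x = \sum_(g <- dom x) << c * coeff g x *g g >> by [].
rewrite -[in RHS](freeg_sumE x) !(raddf_sum (fglift f)) scaler_sumr /=.
by apply: eq_bigr => g _; rewrite !liftU scalerA.
Qed.
HB.instance Definition _ := GRing.isScalable.Build F {freeg G / F} M *:%R
  (fglift f) fglift_scalable.

Lemma fglift_gen g : fglift f << g >> = f g.
Proof. by rewrite liftU scale1r. Qed.

Hypothesis f_rels : forall r, rels r -> fglift f r = 0.

(* The otherwise unused hypothesis is what makes this linear. *)
Definition pres_lift of (forall r, rels r -> fglift f r = 0) :=
  fun x : presmod => fglift f (repr x).
Local Notation lift := (pres_lift f_rels).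

Lemma pres_lift_pi (D : {freeg G / F}) :
  lift (pi D) = fglift f D.
Proof.
apply/eqP; rewrite -subr_eq0 -raddfB; apply/eqP.
have /quotmod_eqP/asboolP[s [sr ->]] :
    pi (repr (pi D)) = pi D.
  by rewrite quotmod_reprK.
rewrite raddf_sum big_seq big1 // => q /sr fq.
by rewrite /= fglift_scalable f_rels // scaler0.
Qed.

Lemma pres_lift_gen g : lift (gen g) = f g.
Proof. by rewrite pres_lift_pi fglift_gen. Qed.

Fact pres_lift_linear : linear lift.
Proof.
move=> a x y; rewrite -(quotmod_reprK x) -(quotmod_reprK y).
by rewrite -quotmod_pi_linear !pres_lift_pi raddfD /= fglift_scalable.
Qed.
HB.instance Definition _ := GRing.isLinear.Build F presmod M *:%R
  lift pres_lift_linear.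

End Lift.
End Presentation.

Section Kahler.
Variables (A : comPzRingType) (K : fieldType) (phi : {rmorphism A -> K}).

Inductive kahler_rel : {freeg K / K} -> Prop :=
| KahlerD x y : kahler_rel (<< x + y >> - (<< x >> + << y >>))
| KahlerM x y : kahler_rel (<< x * y >> - (x *: << y >> + y *: << x >>))
| KahlerC a : kahler_rel << phi a >>.

Definition kahler := presmod kahler_rel.
HB.instance Definition _ := GRing.Lmodule.on kahler.

Definition kahler_d (x : K) : kahler := gen kahler_rel x.

End Kahler.

(* Restriction of scalars of an L-module along iota. *)
Definition restr (K L : fieldType) (iota : {rmorphism K -> L})
  (M : lmodType L) : Type := M.

Section Restr.
Variables (K L : fieldType) (iota : {rmorphism K -> L}) (M : lmodType L).

HB.instance Definition _ := GRing.Zmodule.on (restr iota M).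

Definition restr_scale (a : K) (x : restr iota M) : restr iota M :=
  iota a *: (x : M).

Fact restr_scalerA a b x :
  restr_scale a (restr_scale b x) = restr_scale (a * b) x.
Proof. by rewrite /restr_scale scalerA rmorphM. Qed.
Fact restr_scale1r : left_id 1 restr_scale.
Proof. by move=> x; rewrite /restr_scale rmorph1 scale1r. Qed.
Fact restr_scalerDr : right_distributive restr_scale +%R.
Proof. by move=> a x y; rewrite /restr_scale [LHS]scalerDr. Qed.
Fact restr_scalerDl x : {morph restr_scale^~ x : a b / a + b}.
Proof. by move=> a b; rewrite /restr_scale rmorphD [LHS]scalerDl. Qed.

HB.instance Definition _ := GRing.Zmodule_isLmodule.Build K (restr iota M)
  restr_scalerA restr_scale1r restr_scalerDr restr_scalerDl.

End Restr.

Section KahlerMap.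
Variables (A : comPzRingType) (K L : fieldType).
Variables (phi : {rmorphism A -> K}) (iota : {rmorphism K -> L}).

Definition kahler_map_gen (b : K) : restr iota (kahler (iota \o phi)) :=
  kahler_d (iota \o phi) (iota b).

Fact kahler_map_rels r : kahler_rel phi r -> fglift kahler_map_gen r = 0.
Proof.
have rel := @presmod_rel _ _ (kahler_rel (iota \o phi)).
case=> [x y|x y|a].
- rewrite raddfB raddfD /= !fglift_gen; apply/eqP; rewrite subr_eq0; apply/eqP.
  rewrite /kahler_map_gen rmorphD /kahler_d /gen (rel _ _ (KahlerD _ _ _)).
  exact: raddfD.
- rewrite raddfB raddfD /= !fglift_scalable !fglift_gen.
  apply/eqP; rewrite subr_eq0; apply/eqP.
  rewrite /kahler_map_gen rmorphM /kahler_d /gen (rel _ _ (KahlerM _ _ _)).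
  by rewrite raddfD /= !linearZ.
- rewrite fglift_gen /kahler_map_gen.
  have := rel << iota (phi a) >> 0; rewrite subr0.
  by move=> /(_ (KahlerC (iota \o phi) a)) e; rewrite /kahler_d /gen e raddf0.
Qed.

Definition kahler_map (x : kahler phi) : kahler (iota \o phi) :=
  pres_lift kahler_map_rels x.

Fact kahler_map_linear : linear_for (iota \; *:%R) kahler_map.
Proof. by move=> a x y; apply: (pres_lift_linear kahler_map_rels). Qed.
HB.instance Definition _ := GRing.isLinear.Build K (kahler phi)
  (kahler (iota \o phi)) (iota \; *:%R) kahler_map kahler_map_linear.

Lemma kahler_map_d b :
  kahler_map (kahler_d phi b) = kahler_d (iota \o phi) (iota b).
Proof. exact: (pres_lift_gen kahler_map_rels). Qed.

End KahlerMap.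
Arguments kahler_map {A K L} phi iota _.

(* The tensor product M (x)_K L with its L-module structure given by the second
   factor, as the L-module generated by symbols m (x) a. *)
Section BaseChange.
Variables (K L : fieldType) (iota : {rmorphism K -> L}) (M : lmodType K).

Inductive tensor_rel : {freeg (M * L)%type / L} -> Prop :=
| TensorDl m m' a :
    tensor_rel (<< (m + m', a) >> - (<< (m, a) >> + << (m', a) >>))
| TensorDr m a a' :
    tensor_rel (<< (m, a + a') >> - (<< (m, a) >> + << (m, a') >>))
| TensorK c m a : tensor_rel (<< (c *: m, a) >> - << (m, iota c * a) >>)
| TensorL b m a : tensor_rel (<< (m, b * a) >> - b *: << (m, a) >>).

Definition base_change := presmod tensor_rel.
HB.instance Definition _ := GRing.Lmodule.on base_change.

Definition tensor (m : M) (a : L) : base_change := gen tensor_rel (m, a).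

Lemma tensorDl m m' a : tensor (m + m') a = tensor m a + tensor m' a.
Proof. by rewrite /tensor /gen (presmod_rel (TensorDl _ _ _)) raddfD. Qed.
Lemma tensorDr m a a' : tensor m (a + a') = tensor m a + tensor m a'.
Proof. by rewrite /tensor /gen (presmod_rel (TensorDr _ _ _)) raddfD. Qed.
Lemma tensorK c m a : tensor (c *: m) a = tensor m (iota c * a).
Proof. by rewrite /tensor /gen (presmod_rel (TensorK _ _ _)). Qed.
Lemma tensorL b m a : tensor m (b * a) = b *: tensor m a.
Proof. by rewrite /tensor /gen (presmod_rel (TensorL _ _ _)) linearZ. Qed.

Lemma tensor_span z : exists s : seq (M * L), z = \sum_(q <- s) tensor q.1 q.2.
Proof.
have [s ->] := presmod_span z; exists [seq (q.2.1, q.1 * q.2.2) | q <- s].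
by rewrite big_map; apply: eq_bigr => -[b [m a]] _ /=; rewrite tensorL.
Qed.

Section Lift.
Variables (N : lmodType L) (f : {linear M -> N | iota \; *:%R}).

Definition base_change_lift_gen (q : M * L) : N := q.2 *: f q.1.

Fact base_change_lift_rels r :
  tensor_rel r -> fglift base_change_lift_gen r = 0.
Proof.
case=> [m m' a|m a a'|c m a|b m a]; rewrite raddfB /=; apply/eqP;
  rewrite subr_eq0; apply/eqP; rewrite ?raddfD /= ?fglift_scalable;
  rewrite !fglift_gen /base_change_lift_gen /=.
- by rewrite raddfD -scalerDr.
- by rewrite scalerDl.
- by rewrite linearZ_LR /= mulrC -scalerA.
- by rewrite scalerA.
Qed.

(* m (x) a |-> a *: f m *)
Definition base_change_lift : base_change -> N :=
  pres_lift base_change_lift_rels.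
HB.instance Definition _ := GRing.Linear.on base_change_lift.

Lemma base_change_lift_tensor m a :
  base_change_lift (tensor m a) = a *: f m.
Proof. exact: pres_lift_gen. Qed.

End Lift.
End BaseChange.

Section Psi.
Variables (A : comPzRingType) (K L : fieldType).
Variables (phi : {rmorphism A -> K}) (iota : {rmorphism K -> L}).

Definition psi : base_change iota (kahler phi) -> kahler (iota \o phi) :=
  base_change_lift (kahler_map phi iota).
HB.instance Definition _ := GRing.Linear.on psi.

Lemma psi_tensor m a :
  psi (tensor iota m a) = a *: kahler_map phi iota m.
Proof. exact: base_change_lift_tensor. Qed.

End Psi.
Arguments psi {A K L} phi iota _.

(* inf max_j w(j) over the finite families (j) with x = sum_j t(j); the maximum
   of the empty family is 0. *)
Section RepresentationNorm.
Variables (R : realType) (V : zmodType) (J : Type) (t : J -> V) (w : J -> R).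

Definition rep_norm (x : V) : R :=
  inf [set r | exists s : seq J,
    x = \sum_(j <- s) t j /\ r = \big[Num.max/0]_(j <- s) w j].

Hypothesis w_ge0 : forall j, 0 <= w j.
Hypothesis t_gen : forall x, exists s : seq J, x = \sum_(j <- s) t j.

Lemma bigmax_w_ge0 (s : seq J) : 0 <= \big[Num.max/0]_(j <- s) w j.
Proof.
elim: s => [|j s IH]; first by rewrite big_nil.
by rewrite big_cons le_max w_ge0.
Qed.

Lemma rep_norm_le (s : seq J) :
  rep_norm (\sum_(j <- s) t j) <= \big[Num.max/0]_(j <- s) w j.
Proof.
apply: ge_inf; last by exists s.
by exists 0 => _ [s' [_ ->]]; exact: bigmax_w_ge0.
Qed.

Lemma le_rep_norm x r :
  (forall s : seq J, x = \sum_(j <- s) t j ->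
     r <= \big[Num.max/0]_(j <- s) w j) -> r <= rep_norm x.
Proof.
move=> rle; apply: lb_le_inf; last by move=> _ [s [xs ->]]; exact: rle.
by have [s xs] := t_gen x; exists (\big[Num.max/0]_(j <- s) w j); exists s.
Qed.

Lemma rep_norm_ge0 x : 0 <= rep_norm x.
Proof. by apply: le_rep_norm => s _; exact: bigmax_w_ge0. Qed.

Lemma rep_normD x y : rep_norm (x + y) <= Num.max (rep_norm x) (rep_norm y).
Proof.
have bigmax_cat (s s' : seq J) : \big[Num.max/0]_(j <- s ++ s') w j =
    Num.max (\big[Num.max/0]_(j <- s) w j) (\big[Num.max/0]_(j <- s') w j).
  elim: s => [|j s IH]; last by rewrite !big_cons IH maxA.
  by rewrite big_nil max_r // bigmax_w_ge0.
have approx z e : 0 < e -> exists s : seq J,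
    z = \sum_(j <- s) t j /\ \big[Num.max/0]_(j <- s) w j < rep_norm z + e.
  move=> e0; have [|_ [s [zs ->]] se] := @inf_adherent R
    [set r | exists s : seq J,
      z = \sum_(j <- s) t j /\ r = \big[Num.max/0]_(j <- s) w j] e e0.
    split; last by exists 0 => _ [s [_ ->]]; exact: bigmax_w_ge0.
    by have [s zs] := t_gen z; exists (\big[Num.max/0]_(j <- s) w j); exists s.
  by exists s.
apply/ler_addgt0Pr => e e0.
have [s [xs slt]] := approx x e e0; have [s' [ys s'lt]] := approx y e e0.
rewrite [in leLHS]xs [in leLHS]ys -big_cat (le_trans (rep_norm_le _)) //.
rewrite bigmax_cat ge_max -!lerBlDr !le_max !lerBlDr (ltW slt) (ltW s'lt).
by rewrite orbT.
Qed.

Lemma rep_norm_mor (W : zmodType) (f : {additive V -> W}) (q : W -> R) :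
    q 0 = 0 -> (forall x y, q (x + y) <= Num.max (q x) (q y)) ->
    (forall j, q (f (t j)) <= w j) -> forall x, q (f x) <= rep_norm x.
Proof.
move=> q0 qD fw x; apply: le_rep_norm => s ->; rewrite raddf_sum.
elim: s => [|j s IH]; first by rewrite !big_nil q0.
by rewrite !big_cons (le_trans (qD _ _)) // ge_max !le_max fw IH orbT.
Qed.

End RepresentationNorm.

Section RepresentationSeminorm.
Variables (R : realType) (F : fieldType) (v : valuation R F) (V : lmodType F).
Variables (J : Type) (t : J -> V) (w : J -> R) (act : F -> J -> J).
Hypothesis w_ge0 : forall j, 0 <= w j.
Hypothesis t_gen : forall x, exists s : seq J, x = \sum_(j <- s) t j.
Hypothesis t_act : forall a j, t (act a j) = a *: t j.
Hypothesis w_act : forall a j, w (act a j) = v a * w j.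

Lemma rep_normZ a x : rep_norm t w (a *: x) = v a * rep_norm t w x.
Proof.
have leZ b y : rep_norm t w (b *: y) <= v b * rep_norm t w y.
  have [->|b0] := eqVneq b 0.
    rewrite scale0r v0 mul0r.
    by have := rep_norm_le t w_ge0 [::]; rewrite !big_nil.
  rewrite mulrC -ler_pdivrMr ?v_gt0 //; apply: le_rep_norm => // s ->.
  rewrite ler_pdivrMr ?v_gt0 // mulrC scaler_sumr.
  have -> : \sum_(j <- s) b *: t j = \sum_(j <- map (act b) s) t j.
    by rewrite big_map; apply: eq_bigr => j _; rewrite t_act.
  rewrite (le_trans (rep_norm_le _ _ _)) // big_map.
  elim: s => [|j s IH]; first by rewrite !big_nil mulr0.
  by rewrite !big_cons maxr_pMr ?v_ge0 // w_act ge_max !le_max lexx IH orbT.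
apply/eqP; rewrite eq_le leZ /=.
have [->|a0] := eqVneq a 0; first by rewrite v0 mul0r rep_norm_ge0.
rewrite -[in leLHS](scalerK a0 x) (le_trans (ler_wpM2l (v_ge0 v a) (leZ _ _))) //.
by rewrite mulrA -vM divff // v1 mul1r.
Qed.

Definition rep_seminorm : seminorm v V :=
  Seminorm (rep_norm_ge0 w_ge0 t_gen) rep_normZ (rep_normD w_ge0 t_gen).

End RepresentationSeminorm.

Section KahlerSeminorm.
Variables (R : realType) (A : comPzRingType) (K : fieldType).
Variables (v : valuation R K) (phi : {rmorphism A -> K}).

Let t (q : K * K) : kahler phi := q.1 *: kahler_d phi q.2.
Let w (q : K * K) : R := v q.1 * v q.2.

Fact kahler_w_ge0 q : 0 <= w q.
Proof. by rewrite mulr_ge0 ?v_ge0. Qed.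

Fact kahler_t_gen x : exists s : seq (K * K), x = \sum_(q <- s) t q.
Proof. exact: presmod_span. Qed.

Fact kahler_t_act a q : t (a * q.1, q.2) = a *: t q.
Proof. by rewrite /t scalerA. Qed.

Fact kahler_w_act a q : w (a * q.1, q.2) = v a * w q.
Proof. by rewrite /w vM mulrA. Qed.

(* inf max_i |c_i| |b_i| over the representations x = sum_i c_i d(b_i) *)
Definition kahler_seminorm : seminorm v (kahler phi) :=
  rep_seminorm kahler_w_ge0 kahler_t_gen kahler_t_act kahler_w_act.

Lemma kahler_seminorm_d b : kahler_seminorm (kahler_d phi b) <= v b.
Proof.
have := rep_norm_le t kahler_w_ge0 [:: (1, b)].
by rewrite big_seq1 big_cons big_nil /w /t /= scale1r v1 mul1r max_l ?v_ge0.
Qed.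

End KahlerSeminorm.

Section TensorSeminorm.
Variables (R : realType) (K L : fieldType) (iota : {rmorphism K -> L}).
Variables (vK : valuation R K) (vL : valuation R L).
Variables (M : lmodType K) (p : seminorm vK M).

Let t (q : M * L) : base_change iota M := tensor iota q.1 q.2.
Let w (q : M * L) : R := p q.1 * vL q.2.

Fact tensor_w_ge0 q : 0 <= w q.
Proof. by rewrite mulr_ge0 ?v_ge0 ?sn_ge0. Qed.

Fact tensor_t_gen x : exists s : seq (M * L), x = \sum_(q <- s) t q.
Proof. exact: tensor_span. Qed.

Fact tensor_t_act a q : t (q.1, a * q.2) = a *: t q.
Proof. exact: tensorL. Qed.

Fact tensor_w_act a q : w (q.1, a * q.2) = vL a * w q.
Proof. by rewrite /w vM mulrCA. Qed.

(* inf max_i p(m_i) |a_i| over the representations z = sum_i m_i (x) a_i *)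
Definition tensor_seminorm : seminorm vL (base_change iota M) :=
  rep_seminorm tensor_w_ge0 tensor_t_gen tensor_t_act tensor_w_act.

End TensorSeminorm.

Section NonExpansive.
Variables (R : realType) (A : comPzRingType) (K L : fieldType).
Variables (vK : valuation R K) (vL : valuation R L).
Variables (phi : {rmorphism A -> K}) (iota : {rmorphism K -> L}).
Hypothesis iota_ext : forall x, vL (iota x) = vK x.

Lemma kahler_map_le x : kahler_seminorm vL (iota \o phi) (kahler_map phi iota x)
  <= kahler_seminorm vK phi x.
Proof.
apply: (rep_norm_mor (kahler_t_gen (phi := phi)) (f := kahler_map phi iota)).
- exact: sn0.
- exact: snD.
move=> [c b] /=; rewrite linearZ_LR /= kahler_map_d.
rewrite [leLHS](snZ (kahler_seminorm vL (iota \o phi)) (iota c)) iota_ext.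
by rewrite ler_wpM2l ?v_ge0 // -iota_ext kahler_seminorm_d.
Qed.

Lemma psi_le z : kahler_seminorm vL (iota \o phi) (psi phi iota z)
  <= tensor_seminorm iota vL (kahler_seminorm vK phi) z.
Proof.
apply: (rep_norm_mor (@tensor_t_gen _ _ _ _) (f := psi phi iota)).
- exact: sn0.
- exact: snD.
move=> [m a] /=; rewrite psi_tensor.
rewrite [leLHS](snZ (kahler_seminorm vL (iota \o phi)) a) mulrC.
by rewrite ler_wpM2r ?v_ge0 // kahler_map_le.
Qed.

End NonExpansive.
Arguments kahler_map_le {R A K L vK vL} phi {iota} iota_ext x.
Arguments psi_le {R A K L vK vL} phi {iota} iota_ext z.

(* Hausdorff completion: Cauchy sequences modulo null sequences. *)
Section Completion.
Variables (R : realType) (F : fieldType) (v : valuation R F).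
Variables (V : lmodType F) (p : seminorm v V).

Definition is_cauchy : {pred nat -> V} := fun u =>
  `[< forall e : R, 0 < e -> exists N, forall m n,
        (N <= m)%N -> (N <= n)%N -> p (u m - u n) < e >].

Fact is_cauchy_submod : submod_closed is_cauchy.
Proof.
split.
  apply/asboolP => e e0; exists 0%N => m n _ _.
  by rewrite /= subr0 sn0.
move=> a x y /asboolP cx /asboolP cy; apply/asboolP => e e0.
have va1 : 0 < v a + 1 by rewrite ltr_wpDl ?v_ge0.
have [N1 h1] := cx (e / (v a + 1)) (divr_gt0 e0 va1).
have [N2 h2] := cy e e0.
exists (maxn N1 N2) => m n; rewrite !geq_max => /andP[m1 m2] /andP[n1 n2].
have -> : (a *: x + y) m - (a *: x + y) n
    = a *: (x m - x n) + (y m - y n).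
  by rewrite scalerBr addrACA -opprD.
rewrite (le_lt_trans (snD _ _ _)) // gt_max h2 // andbT snZ.
have := h1 _ _ m1 n1; rewrite ltr_pdivlMr // => /(le_lt_trans _) -> //.
by rewrite mulrC ler_wpM2l ?sn_ge0 // lerDl.
Qed.
HB.instance Definition _ := GRing.isSubmodClosed.Build F (nat -> V) is_cauchy
  is_cauchy_submod.

Record cauchy_seq := CauchySeq {
  cseq :> nat -> V;
  cseqP : cseq \in is_cauchy }.
HB.instance Definition _ := [isSub for cseq].
HB.instance Definition _ := [Choice of cauchy_seq by <:].
HB.instance Definition _ := [SubChoice_isSubLmodule of cauchy_seq by <:].

Definition is_null : {pred cauchy_seq} := fun u =>
  `[< forall e : R, 0 < e -> exists N, forall n, (N <= n)%N -> p (u n) < e >].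

Fact is_null_submod : submod_closed is_null.
Proof.
split; first by apply/asboolP => e e0; exists 0%N => n _; rewrite /= sn0.
move=> a x y /asboolP cx /asboolP cy; apply/asboolP => e e0.
have va1 : 0 < v a + 1 by rewrite ltr_wpDl ?v_ge0.
have [N1 h1] := cx (e / (v a + 1)) (divr_gt0 e0 va1).
have [N2 h2] := cy e e0.
exists (maxn N1 N2) => n; rewrite geq_max => /andP[n1 n2].
rewrite (le_lt_trans (snD _ _ _)) // gt_max h2 // andbT snZ.
have := h1 _ n1; rewrite ltr_pdivlMr // => /(le_lt_trans _) -> //.
by rewrite mulrC ler_wpM2l ?sn_ge0 // lerDl.
Qed.

Definition completion := quotmod is_null_submod.
HB.instance Definition _ := GRing.Lmodule.on completion.

Definition completion_norm (x : completion) : R :=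
  limn (fun n => p (repr x n)).

Fact const_cauchy x : (fun=> x) \in is_cauchy.
Proof. by apply/asboolP => e e0; exists 0%N => m n _ _; rewrite subrr sn0. Qed.

Definition to_completion (x : V) : completion :=
  quotmod_pi is_null_submod (CauchySeq (const_cauchy x)).

Lemma sn_distr x y : `|p x - p y| <= p (x - y).
Proof.
wlog le : x y / p y <= p x => [h|].
  have [/h //|/ltW /h] := leP (p y) (p x).
  by rewrite distrC -(snN p (y - x)) opprB.
rewrite ger0_norm ?subr_ge0 // lerBlDr -{1}(subrK y x) (le_trans (snD _ _ _)) //.
by rewrite ge_max lerDl sn_ge0 lerDr sn_ge0.
Qed.

Lemma cauchy_seq_cvg (u : cauchy_seq) : cvgn (fun n => p (u n)).
Proof.
apply/cauchy_cvgP/cauchy_exP => e e0.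
have /asboolP/(_ e e0)[N hN] := cseqP u.
exists (p (u N)), N => // n Nn.
by apply: le_lt_trans (sn_distr _ _) (hN _ _ _ _).
Qed.

Lemma completion_normE (u : cauchy_seq) :
  completion_norm (quotmod_pi is_null_submod u) = limn (fun n => p (u n)).
Proof.
have /quotmod_eqP/asboolP h := quotmod_reprK (quotmod_pi is_null_submod u).
apply: cvg_lim => //; set w := repr _ in h *.
have -> : (fun n => p (w n)) = (fun n => p (u n)) + (fun n => p (w n) - p (u n)).
  by apply/funext => n /=; rewrite !fctE addrC subrK.
rewrite -[limn _]addr0; apply: cvgD; first exact: cauchy_seq_cvg.
apply/cvgr0Pnorm_lt => e e0; have [N hN] := h e e0.
by exists N => // n Nn; apply: le_lt_trans (sn_distr _ _) (hN _ _).
Qed.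

Lemma completion_norm_to_completion x : completion_norm (to_completion x) = p x.
Proof. by rewrite completion_normE; apply: cvg_lim => //=; exact: cvg_cst. Qed.

End Completion.
Arguments completion_norm {R F v V} p x.
Arguments to_completion {R F v V} p x.

Section CompletedMap.
Variables (R : realType) (F F' : fieldType).
Variables (v : valuation R F) (v' : valuation R F').
Variables (V : lmodType F) (W : lmodType F').
Variables (p : seminorm v V) (q : seminorm v' W) (f : {additive V -> W}).
Hypothesis f_le : forall x, q (f x) <= p x.

Fact map_cauchy (u : cauchy_seq p) : (fun n => f (u n)) \in is_cauchy q.
Proof.
have /asboolP cu := cseqP u; apply/asboolP => e e0.
have [N h] := cu e e0; exists N => m n Nm Nn.
by rewrite -raddfB (le_lt_trans (f_le _)) // h.
Qed.

Definition completed_map (x : completion p) : completion q :=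
  quotmod_pi (is_null_submod q) (CauchySeq (map_cauchy (repr x))).

Lemma completed_mapE (u : cauchy_seq p) :
  completed_map (quotmod_pi (is_null_submod p) u) =
  quotmod_pi (is_null_submod q) (CauchySeq (map_cauchy u)).
Proof.
have /quotmod_eqP/asboolP h := quotmod_reprK
  (quotmod_pi (is_null_submod p) u).
apply/quotmod_eqP/asboolP => e e0; have [N hN] := h e e0.
exists N => n Nn; apply: le_lt_trans (hN n Nn); rewrite /completed_map.
set w := repr _.
have -> : (CauchySeq (map_cauchy w) - CauchySeq (map_cauchy u)) n =
    f ((w - u) n) by rewrite [RHS]raddfB.
exact: f_le.
Qed.

Lemma completed_map_to_completion x :
  completed_map (to_completion p x) = to_completion q (f x).
Proof.
rewrite /to_completion completed_mapE; congr quotmod_pi.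
exact: val_inj.
Qed.

End CompletedMap.
Arguments completed_map {R F F' v v' V W p q} f f_le x.

(* Isomorphisms of seminormed modules; s is [*:%R] for linear maps and
   [iota \; *:%R] for maps that are linear along iota. *)
Definition isometric_isomorphism (R : realType) (F : fieldType)
    (V : lmodType F) (W : zmodType) (p : V -> R) (q : W -> R)
    (s : F -> W -> W) (f : V -> W) : Prop :=
  [/\ linear_for s f, bijective f & forall x, q (f x) = p x].

(* Main.v *)
(* Approximating the scalars of L by elements of K turns the completion of a
   seminormed K-module into an L-module. The derivation d : K -> Omega_K, being
   contractive, extends by continuity to an A-derivation of L into the completion
   of Omega_K, hence to a contractive L-linear map theta from Omega_L to it, and
   theta o kappa is the canonical map for kappa : Omega_K -> Omega_L. Contractivity
   of kappa and theta forces kappa to be isometric. Both kappa and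
   m |-> m (x) 1 have dense image, and psi (m (x) 1) = kappa m, so psi is isometric
   with dense image too. *)

From HB Require Import structures.
Require Import Defs.
From mathcomp Require Import all_boot all_order all_algebra.
From mathcomp Require Import boolp classical_sets functions reals.
From mathcomp Require Import topology normedtype sequences.
From mathcomp.multinomials Require Import freeg.

Set Implicit Arguments.
Unset Strict Implicit.
Unset Printing Implicit Defensive.

Import Order.TTheory GRing.Theory Num.Theory.
Import numFieldNormedType.Exports.

Local Open Scope classical_set_scope.
Local Open Scope ring_scope.

(** * Valuations as seminorms, and the norm on a completion *)

Section Valuation.
Variables (R : realType) (F : fieldType) (v : valuation R F).

(** Viewing [F] as a module over itself makes the lemmas on seminorms available for valuations. *)
Definition valuation_seminorm : seminorm v F^o :=
  @Seminorm _ _ v F^o v (v_ge0 v) (vM v) (vD v).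

Lemma vN a : v (- a) = v a.
Proof. exact: (snN valuation_seminorm). Qed.

End Valuation.

Section SeminormCompletion.
Variables (R : realType) (F : fieldType) (v : valuation R F).
Variables (V : lmodType F) (p : seminorm v V).

Lemma sn_le_add x y : p (x + y) <= p x + p y.
Proof. by rewrite (le_trans (snD _ _ _)) // ge_max lerDl lerDr !sn_ge0. Qed.

(** This passes from the epsilon form used in [is_null] to filter convergence, where limits can be
    added, multiplied and squeezed. *)
Lemma sn_cvg0P (u : nat -> V) :
  (forall e : R, 0 < e -> exists N, forall n, (N <= n)%N -> p (u n) < e) <->
  (p (u n) @[n --> \oo] --> (0 : R)).
Proof.
split=> [h|/cvgr0Pnorm_lt h e e0].
  apply/cvgr0Pnorm_lt => e /h[N hN]; exists N => // n /= /hN.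
  by rewrite ger0_norm ?sn_ge0.
by have [N _ hN] := h e e0; exists N => n /hN; rewrite ger0_norm ?sn_ge0.
Qed.

Definition class_of (u : cauchy_seq p) : completion p :=
  quotmod_pi (is_null_submod p) u.
Fact class_of_linear : linear class_of.
Proof. exact: quotmod_pi_linear. Qed.
HB.instance Definition _ := GRing.isLinear.Build F (cauchy_seq p)
  (completion p) *:%R class_of class_of_linear.

Lemma class_of_surj (x : completion p) : exists u, x = class_of u.
Proof. by exists (repr x); rewrite /class_of quotmod_reprK. Qed.

Lemma class_of_eq (u w : cauchy_seq p) :
  class_of u = class_of w <-> p (u n - w n) @[n --> \oo] --> (0 : R).
Proof.
rewrite -sn_cvg0P /class_of quotmod_eqP; split; first by move/asboolP.
by move=> h; apply/asboolP.
Qed.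

Lemma completion_norm_cvg (u : cauchy_seq p) :
  p (u n) @[n --> \oo] --> completion_norm p (class_of u).
Proof. by rewrite /class_of completion_normE; exact: cauchy_seq_cvg. Qed.

Lemma completion_norm_ge0 (x : completion p) : 0 <= completion_norm p x.
Proof.
by apply: limr_ge; [exact: cauchy_seq_cvg|near=> n; exact: sn_ge0].
Unshelve. all: by end_near. Qed.

(** The completion is Hausdorff: the norm of a class is the limit of [p (u n)], and if that limit is
    0 then [u] is a null sequence. *)
Lemma completion_norm_eq0 x : completion_norm p x = 0 -> x = 0.
Proof.
have [u ->] := class_of_surj x; have := completion_norm_cvg (u := u).
move=> /[swap] -> h; rewrite -(raddf0 class_of); apply/class_of_eq.
by under eq_fun do rewrite subr0.
Qed.

Lemma completion_norm0 : completion_norm p 0 = 0.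
Proof.
rewrite -(sn0 p) -completion_norm_to_completion -(raddf0 class_of).
by rewrite /class_of; congr (completion_norm p (quotmod_pi _ _)); exact: val_inj.
Qed.

Lemma completion_normD x y : completion_norm p (x + y) <=
  Num.max (completion_norm p x) (completion_norm p y).
Proof.
have [u ->] := class_of_surj x; have [w ->] := class_of_surj y.
rewrite -raddfD; apply/ler_addgt0Pr => e e0.
have := completion_norm_cvg (u := u + w).
have := completion_norm_cvg (u := u); have := completion_norm_cvg (u := w).
set b := completion_norm _ _; set a := completion_norm _ _.
move=> /cvgr_le wb /cvgr_le ua /cvg_lim <- //; apply: limr_le.
  exact: cauchy_seq_cvg.
(* Both limits are at most [Num.max a b], so both sequences eventually stay below [Num.max a b + e],
   and by the ultrametric inequality so does their sum. *)
have me z : z <= Num.max a b -> z < Num.max a b + e.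
  by move=> zm; rewrite (le_lt_trans zm) // ltrDl.
have ha := ua _ (me a _); have hb := wb _ (me b _).
near=> n; rewrite (le_trans (snD _ _ _)) // ge_max; apply/andP; split; near: n.
  by apply: ha; rewrite le_max lexx.
by apply: hb; rewrite le_max lexx orbT.
Unshelve. all: by end_near. Qed.

End SeminormCompletion.

(** * Completion of an isometry with dense image *)

Section CompletedIsometry.
Variables (R : realType) (F F' : fieldType) (j : {rmorphism F -> F'}).
Variables (v : valuation R F) (v' : valuation R F').
Variables (V : lmodType F) (W : lmodType F').
Variables (p : seminorm v V) (q : seminorm v' W) (f : {additive V -> W}).
Hypothesis f_le : forall x, q (f x) <= p x.
Hypothesis fZ : forall a x, f (a *: x) = j a *: f x.
Hypothesis f_isometry : forall x, q (f x) = p x.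
Hypothesis f_dense : forall y (e : R), 0 < e -> exists x, q (y - f x) < e.

Let g := completed_map f f_le.

Let g_class_of u : g (class_of u) = class_of (CauchySeq (map_cauchy f_le u)).
Proof. exact: completed_mapE. Qed.

Let g_linear : linear_for (j \; *:%R) g.
Proof.
move=> a x y; have [u ->] := class_of_surj x; have [w ->] := class_of_surj y.
rewrite -linearP !g_class_of /= -linearP; congr class_of; apply/val_inj.
by apply/funext => n /=; rewrite raddfD fZ.
Qed.

Let g_isometry x : completion_norm q (g x) = completion_norm p x.
Proof.
have [u ->] := class_of_surj x; rewrite g_class_of /class_of !completion_normE.
by under eq_fun do rewrite f_isometry.
Qed.

(** Density gives preimages [s n] of [w n] up to 1/(n+1). Since [f] is isometric, the Cauchy
    property of [w] carries back to [s], whose class is then mapped to that of [w]. *)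
Let g_surj y : exists x, g x = y.
Proof.
have [w ->] := class_of_surj y.
have /choice[s sP] : forall n, exists x, q (w n - f x) < n.+1%:R^-1.
  by move=> n; apply: f_dense; rewrite invr_gt0.
have s0 : q (w n - f (s n)) @[n --> \oo] --> (0 : R).
  apply: (squeeze_cvgr _ (cvg_cst (0 : R)) cvg_harmonic).
  by near=> n; rewrite sn_ge0 ltW.
have s_cauchy : s \in is_cauchy p.
  apply/asboolP => e e0; have /asboolP/(_ e e0)[N1 h1] := cseqP w.
  have /sn_cvg0P/(_ e e0)[N2 h2] := s0.
  exists (maxn N1 N2) => m n; rewrite !geq_max => /andP[m1 m2] /andP[n1 n2].
  have -> : p (s m - s n) =
      q ((w m - w n) + ((w n - f (s n)) - (w m - f (s m)))).
    rewrite -f_isometry raddfB; congr (q _).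
    by rewrite opprB addrA subrKA [RHS]addrC subrKA.
  by do 2!rewrite (le_lt_trans (snD _ _ _)) // gt_max ?snN ?h1 ?h2 //=.
exists (class_of (CauchySeq s_cauchy)); rewrite g_class_of.
apply/class_of_eq; under eq_fun do rewrite -snN opprB; exact: s0.
Unshelve. all: by end_near. Qed.

(** Injectivity holds because a norm-preserving map out of a Hausdorff space has trivial kernel. The
    homomorphism [j] lets one statement serve both [psi], with [j] the identity, and [kahler_map],
    with [j] equal to [iota]. *)
Lemma completed_map_isometric_isomorphism :
  isometric_isomorphism (completion_norm p) (completion_norm q) (j \; *:%R) g.
Proof.
split=> //; rewrite -setTT_bijective; split=> // [x y _ _ gxy|y _].
  apply/eqP; rewrite -subr_eq0; apply/eqP/(@completion_norm_eq0 _ _ _ _ p).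
  (* [g] carries no additive structure here, so compatibility with subtraction is drawn from
     semilinearity at the scalar -1. *)
  have gB : g (x - y) = g x - g y.
    by rewrite -scaleN1r addrC g_linear /= rmorphN1 scaleN1r addrC.
  by rewrite -g_isometry gB gxy subrr completion_norm0.
by have [x <-] := g_surj y; exists x.
Qed.

End CompletedIsometry.

(** * Approximation of elements of L by sequences in K *)

(** The limit [l] is kept apart from 0 because limit arithmetic produces expressions such as
    [0 + 0], whose vanishing is then a separate goal. *)
Lemma squeeze_cvg0 (R : realType) (a b : nat -> R) l :
  (forall n, 0 <= a n <= b n) -> l = 0 -> b n @[n --> \oo] --> l ->
  a n @[n --> \oo] --> (0 : R).
Proof.
move=> ab ->; apply: squeeze_cvgr (cvg_cst (0 : R)).
by near=> n; exact: ab.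
Unshelve. all: by end_near. Qed.

Section DenseApproximation.
Variables (R : realType) (K L : fieldType) (vK : valuation R K).
Variables (vL : valuation R L) (iota : {rmorphism K -> L}).
Hypothesis iota_ext : forall x : K, vL (iota x) = vK x.

Definition approximates (k : nat -> K) (y : L) :=
  vL (iota (k n) - y) @[n --> \oo] --> (0 : R).

Lemma approximates_const x : approximates (fun=> x) (iota x).
Proof. by rewrite /approximates subrr v0; exact: cvg_cst. Qed.

Lemma approximatesD k k' y y' : approximates k y -> approximates k' y' ->
  approximates (fun n => k n + k' n) (y + y').
Proof.
move=> ky ky'; apply: (squeeze_cvg0 _ (addr0 0) (cvgD ky ky')) => n.
rewrite v_ge0 /= rmorphD opprD addrACA.
exact: (sn_le_add (valuation_seminorm vL)).
Qed.

Lemma approximates_valuation k y :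
  approximates k y -> vK (k n) @[n --> \oo] --> vL y.
Proof.
move=> /cvgr0Pnorm_lt ky; apply/cvgrPdist_lt => e e0; near=> n.
rewrite -iota_ext distrC.
rewrite (le_lt_trans (sn_distr (valuation_seminorm vL) _ _)) //=.
by rewrite -[ltLHS]ger0_norm ?v_ge0 //; near: n; exact: ky.
Unshelve. all: by end_near. Qed.

Lemma approximatesM k k' y y' : approximates k y -> approximates k' y' ->
  approximates (fun n => k n * k' n) (y * y').
Proof.
move=> ky ky'; have kvy := approximates_valuation ky.
(* The error is at most |k n| |k' n - y'| + |k n - y| |y'|, where |k n| converges to |y| and the
   other varying factors tend to 0. *)
apply: (squeeze_cvg0 _ _ (cvgD (cvgM kvy ky') (cvgM ky (cvg_cst (vL y')))));
  last by rewrite mulr0 mul0r addr0.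
move=> n; rewrite v_ge0 /= rmorphM -iota_ext -!vM.
have -> : iota (k n) * iota (k' n) - y * y' =
    iota (k n) * (iota (k' n) - y') + (iota (k n) - y) * y'.
  by rewrite mulrBr mulrBl addrA subrK.
exact: (sn_le_add (valuation_seminorm vL)).
Qed.

(** This is what makes constructions through approximating sequences independent of the sequence
    chosen. *)
Lemma approximates_sub k k' y : approximates k y -> approximates k' y ->
  vK (k n - k' n) @[n --> \oo] --> (0 : R).
Proof.
move=> ky ky'; apply: (squeeze_cvg0 _ (addr0 0) (cvgD ky ky')) => n.
rewrite v_ge0 -(vN _ (iota (k' n) - y)) /= -iota_ext rmorphB.
rewrite -[iota (k n) - iota (k' n)](subrKA y) (opprB (iota _)).
exact: (sn_le_add (valuation_seminorm vL)).
Qed.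

Lemma approximates_cauchy k y : approximates k y ->
  (k : nat -> K^o) \in is_cauchy (valuation_seminorm vK).
Proof.
move=> /(@sn_cvg0P _ _ _ _ (valuation_seminorm vL)) ky.
apply/asboolP => e /ky[N hN]; exists N => m n Nm Nn /=.
rewrite -iota_ext rmorphB -[iota (k m)](subrK y) -addrA.
rewrite (le_lt_trans (vD _ _ _)) // gt_max.
by rewrite -(vN _ (y - _)) opprB; apply/andP; split; exact: hN.
Qed.

Hypothesis iota_dense : forall (y : L) (e : R), 0 < e ->
  exists x : K, vL (y - iota x) < e.

Lemma approximates_exists y : exists k, approximates k y.
Proof.
have /choice[k kP] : forall n, exists x, vL (y - iota x) < n.+1%:R^-1.
  by move=> n; apply: iota_dense; rewrite invr_gt0.
exists k; apply: (squeeze_cvg0 _ erefl cvg_harmonic) => n.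
by rewrite v_ge0 /= -vN opprB ltW.
Qed.

End DenseApproximation.

(** * The L-module structure on the completion of a K-module *)

(* An alias of the completion: the hypotheses are arguments so that its L-module
   structure, which depends on them, can be inferred from the type. *)
Definition dense_completion (R : realType) (K L : fieldType)
    (vK : valuation R K) (vL : valuation R L) (iota : {rmorphism K -> L})
    (V : lmodType K) (p : seminorm vK V)
    (_ : forall x : K, vL (iota x) = vK x)
    (_ : forall (y : L) (e : R), 0 < e -> exists x : K, vL (y - iota x) < e) :
  Type := completion p.

Section DenseCompletion.
Variables (R : realType) (K L : fieldType) (vK : valuation R K).
Variables (vL : valuation R L) (iota : {rmorphism K -> L}).
Variables (V : lmodType K) (p : seminorm vK V).
Hypothesis iota_ext : forall x : K, vL (iota x) = vK x.
Hypothesis iota_dense : forall (y : L) (e : R), 0 < e ->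
  exists x : K, vL (y - iota x) < e.

Local Notation approx := (approximates vL iota).
Local Notation Vhat := (dense_completion p iota_ext iota_dense).

HB.instance Definition _ := GRing.Zmodule.on Vhat.

(** Both |k n| and [p (u n)] converge, hence are eventually bounded, and the usual estimate for a
    product of Cauchy sequences applies. *)
Fact scale_cauchy k y (u : cauchy_seq p) : approx k y ->
  (fun n => k n *: u n) \in is_cauchy p.
Proof.
move=> ky; have /asboolP k_cauchy := approximates_cauchy iota_ext ky.
have /asboolP u_cauchy := cseqP u; apply/asboolP => e e0.
have bounded (a : nat -> R) l : a n @[n --> \oo] --> l -> 0 <= l ->
    exists2 B, 0 < B & exists N, forall n, (N <= n)%N -> a n <= B.
  (* The bound [l + 1] is positive even if [l] is 0, so [e] can be divided by it. *)
  move=> /cvgr_le al l0; exists (l + 1); first by rewrite ltr_wpDl.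
  have [|N _ hN] := al (l + 1); first by rewrite ltrDl.
  by exists N => n /hN.
have [B B0 [N1 h1]] := bounded _ _ (approximates_valuation iota_ext ky)
  (v_ge0 _ _).
have [C C0 [N2 h2]] := bounded _ _ (completion_norm_cvg (u := u))
  (completion_norm_ge0 _).
have [N3 h3] := k_cauchy _ (divr_gt0 e0 C0).
have [N4 h4] := u_cauchy _ (divr_gt0 e0 B0).
exists (maxn (maxn N1 N2) (maxn N3 N4)) => m n; rewrite !geq_max.
move=> /andP[/andP[m1 m2] /andP[m3 m4]] /andP[/andP[n1 n2] /andP[n3 n4]].
have -> : k m *: u m - k n *: u n = (k m - k n) *: u m + k n *: (u m - u n).
  by rewrite scalerBl scalerBr addrA subrK.
rewrite (le_lt_trans (snD _ _ _)) // gt_max !snZ; apply/andP; split.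
  rewrite (@le_lt_trans _ _ (vK (k m - k n) * C)) //.
    by rewrite ler_wpM2l ?v_ge0 ?h2.
  by rewrite -ltr_pdivlMr // h3.
rewrite (@le_lt_trans _ _ (B * p (u m - u n))) //.
  by rewrite ler_wpM2r ?sn_ge0 ?h1.
by rewrite mulrC -ltr_pdivlMr // h4.
Qed.

Definition approximant (y : L) : nat -> K :=
  projT1 (cid (approximates_exists iota_dense y)).

Lemma approximantP y : approx (approximant y) y.
Proof. exact: projT2 (cid (approximates_exists iota_dense y)). Qed.

Definition dense_scale (y : L) (x : Vhat) : Vhat :=
  class_of (CauchySeq (scale_cauchy (repr (x : completion p)) (approximantP y))).

(** The product depends neither on the approximating sequence nor on the representative. Each module
    law can therefore be checked term by term on sequences suited to it. *)
Lemma dense_scaleE k y (ky : approx k y) (u : cauchy_seq p) :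
  dense_scale y (class_of u) = class_of (CauchySeq (scale_cauchy u ky)).
Proof.
have : class_of (repr (class_of u)) = class_of u.
  by rewrite /class_of quotmod_reprK.
rewrite /dense_scale; set w := repr _ => /class_of_eq wu; apply/class_of_eq => /=.
have ay := approximantP y.
(* The first summand of the bound accounts for the change of representative, the second for the
   change of approximating sequence. *)
apply: (squeeze_cvg0 _ _
  (cvgD (cvgM (approximates_valuation iota_ext ay) wu)
    (cvgM (approximates_sub iota_ext ay ky) (completion_norm_cvg (u := u)))));
  last by rewrite mulr0 mul0r addr0.
move=> n; rewrite sn_ge0 /= -!snZ.
rewrite (le_trans _ (sn_le_add _ _ _)) //.
by rewrite scalerBr scalerBl addrA subrK.
Qed.

Lemma class_of_ext (u w : cauchy_seq p) : u =1 w -> class_of u = class_of w.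
Proof. by move=> uw; congr class_of; apply/val_inj/funext. Qed.

Fact dense_scalerA a b x :
  dense_scale a (dense_scale b x) = dense_scale (a * b) x.
Proof.
have [u ->] := class_of_surj x.
have ha := approximantP a; have hb := approximantP b.
rewrite (dense_scaleE hb) (dense_scaleE ha).
rewrite (dense_scaleE (approximatesM iota_ext ha hb)).
by apply: class_of_ext => n /=; rewrite scalerA.
Qed.

Fact dense_scale1r x : dense_scale 1 x = x.
Proof.
have [u ->] := class_of_surj x.
have h1 := approximates_const vL iota 1; rewrite rmorph1 in h1.
by rewrite (dense_scaleE h1); apply: class_of_ext => n /=; rewrite scale1r.
Qed.

Fact dense_scalerDr : right_distributive dense_scale +%R.
Proof.
move=> a x y; have [u ->] := class_of_surj x; have [w ->] := class_of_surj y.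
have ha := approximantP a; rewrite -[X in dense_scale _ X]raddfD.
rewrite !(dense_scaleE ha) -[RHS]raddfD.
by apply: class_of_ext => n /=; rewrite scalerDr.
Qed.

Fact dense_scalerDl x : {morph dense_scale^~ x : a b / a + b}.
Proof.
move=> a b /=; have [u ->] := class_of_surj x.
have ha := approximantP a; have hb := approximantP b.
rewrite (dense_scaleE ha) (dense_scaleE hb) (dense_scaleE (approximatesD ha hb)).
by rewrite -[RHS]raddfD; apply: class_of_ext => n /=; rewrite scalerDl.
Qed.

HB.instance Definition _ := GRing.Zmodule_isLmodule.Build L Vhat
  dense_scalerA dense_scale1r dense_scalerDr dense_scalerDl.

Lemma completion_norm_dense_scale a (x : Vhat) :
  completion_norm p (a *: x) = vL a * completion_norm p x.
Proof.
rewrite -[a *: x]/(dense_scale a x); have [u ->] := class_of_surj x.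
have ha := approximantP a; rewrite (dense_scaleE ha).
apply: (cvg_unique _ (completion_norm_cvg (u := _))) => //=.
under eq_fun do rewrite snZ.
exact: cvgM (approximates_valuation iota_ext ha) (completion_norm_cvg (u := u)).
Qed.

End DenseCompletion.

(** * Derivation rules for d *)

Section KahlerDifferential.
Variables (A : comPzRingType) (K : fieldType) (phi : {rmorphism A -> K}).

Lemma kahler_dD x y : kahler_d phi (x + y) = kahler_d phi x + kahler_d phi y.
Proof. by rewrite /kahler_d /gen (presmod_rel (KahlerD _ _ _)) raddfD. Qed.

Lemma kahler_dM x y :
  kahler_d phi (x * y) = x *: kahler_d phi y + y *: kahler_d phi x.
Proof.
by rewrite /kahler_d /gen (presmod_rel (KahlerM _ _ _)) raddfD /= !linearZ.
Qed.

Lemma kahler_dC a : kahler_d phi (phi a) = 0.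
Proof.
have := @presmod_rel _ _ (kahler_rel phi) << phi a >> 0.
by rewrite /kahler_d /gen subr0 raddf0 => -> //; exact: KahlerC.
Qed.

Lemma kahler_dB x y : kahler_d phi (x - y) = kahler_d phi x - kahler_d phi y.
Proof. by apply/eqP; rewrite eq_sym subr_eq -kahler_dD subrK. Qed.

End KahlerDifferential.

(** * Extension of d to L, and isometry of kappa *)

Section DenseKahler.
Variables (R : realType) (K L : fieldType) (vK : valuation R K).
Variables (vL : valuation R L) (iota : {rmorphism K -> L}).
Hypothesis iota_ext : forall x : K, vL (iota x) = vK x.
Hypothesis iota_dense : forall (y : L) (e : R), 0 < e ->
  exists x : K, vL (y - iota x) < e.
Variables (A : comPzRingType) (phi : {rmorphism A -> K}).

Local Notation approx := (approximates vL iota).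
Local Notation normK := (kahler_seminorm vK phi).
Local Notation normL := (kahler_seminorm vL (iota \o phi)).
Local Notation normT := (tensor_seminorm iota vL normK).
Local Notation Omegahat := (dense_completion normK iota_ext iota_dense).
Local Notation dK := (kahler_d phi).
Local Notation dL := (kahler_d (iota \o phi)).
Local Notation kappa := (kahler_map phi iota).

(** Since d is additive and contractive, it preserves Cauchy sequences; this is its extension by
    continuity. *)
Fact kahler_d_cauchy k y : approx k y -> (fun n => dK (k n)) \in is_cauchy normK.
Proof.
move=> /(approximates_cauchy iota_ext)/asboolP k_cauchy; apply/asboolP => e e0.
have [N hN] := k_cauchy e e0; exists N => m n Nm Nn.
by rewrite -kahler_dB (le_lt_trans (kahler_seminorm_d _ _ _)) // hN.
Qed.

Definition dense_d (y : L) : Omegahat :=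
  class_of (CauchySeq (kahler_d_cauchy (approximantP iota_dense y))).

(** Free choice of the sequence lets sums and products of approximants stand for those of their
    limits, so the rules for [dense_d] follow termwise from those for d. *)
Lemma dense_dE k y (ky : approx k y) :
  dense_d y = class_of (CauchySeq (kahler_d_cauchy ky)).
Proof.
apply/class_of_eq; have ay := approximantP iota_dense y.
apply: (squeeze_cvg0 _ erefl (approximates_sub iota_ext ay ky)) => n.
by apply/andP; split; [exact: sn_ge0|rewrite -kahler_dB; exact: kahler_seminorm_d].
Qed.

Lemma dense_dD x y : dense_d (x + y) = dense_d x + dense_d y.
Proof.
have hx := approximantP iota_dense x; have hy := approximantP iota_dense y.
rewrite (dense_dE hx) (dense_dE hy) (dense_dE (approximatesD hx hy)) -[RHS]raddfD.
by apply: class_of_ext => n /=; rewrite kahler_dD.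
Qed.

Lemma dense_dM x y : dense_d (x * y) = x *: dense_d y + y *: dense_d x.
Proof.
have hx := approximantP iota_dense x; have hy := approximantP iota_dense y.
rewrite -[x *: _]/(dense_scale x _) -[y *: _]/(dense_scale y _).
rewrite (dense_dE hx) (dense_dE hy) (dense_dE (approximatesM iota_ext hx hy)).
rewrite (dense_scaleE iota_ext iota_dense hx).
rewrite (dense_scaleE iota_ext iota_dense hy) -[RHS]raddfD.
by apply: class_of_ext => n /=; rewrite kahler_dM.
Qed.

Lemma dense_d_iota b : dense_d (iota b) = to_completion normK (dK b).
Proof.
by rewrite (dense_dE (approximates_const vL iota b)); exact: class_of_ext.
Qed.

Lemma completion_norm_dense_d y : completion_norm normK (dense_d y) <= vL y.
Proof.
have hy := approximantP iota_dense y; apply: (ler_cvg_to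
  (completion_norm_cvg (u := _)) (approximates_valuation iota_ext hy)).
by near=> n; exact: kahler_seminorm_d.
Unshelve. all: by end_near. Qed.

(** This is the input of the universal property that yields theta. The images of elements of A lie
    in K, where d already kills them. *)
Fact dense_d_rels r : kahler_rel (iota \o phi) r -> fglift dense_d r = 0.
Proof.
case=> [x y|x y|a].
- by rewrite raddfB raddfD /= !fglift_gen dense_dD subrr.
- by rewrite raddfB raddfD /= !fglift_scalable !fglift_gen dense_dM subrr.
- rewrite fglift_gen /= dense_d_iota kahler_dC.
  by rewrite -[RHS](raddf0 (@class_of _ _ _ _ normK)); exact: class_of_ext.
Qed.

Local Notation theta := (pres_lift dense_d_rels).

Lemma theta_d b : theta (dL b) = dense_d b.
Proof. exact: pres_lift_gen. Qed.

Lemma theta_kappa x : theta (kappa x) = to_completion normK x.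
Proof.
(* On the image of Omega_K the scaling by [iota c] is the original one by [c], as the constant
   sequence approximates [iota c]. *)
have cZ c z : iota c *: (to_completion normK z : Omegahat) =
    to_completion normK (c *: z).
  rewrite -[LHS]/(dense_scale (iota c) _).
  rewrite (dense_scaleE iota_ext iota_dense (approximates_const vL iota c)).
  exact: class_of_ext.
have [s ->] := presmod_span x.
elim: s => [|[c b] s IH].
  rewrite big_nil !raddf0 -(raddf0 (@class_of _ _ _ _ normK)).
  exact: class_of_ext.
rewrite big_cons !raddfD /= IH linearZ_LR /= kahler_map_d linearZ /=.
rewrite theta_d dense_d_iota cZ -[LHS]raddfD; exact: class_of_ext.
Qed.

(** As [normL] is an infimum over representations, it suffices to bound theta on each c d(b), where
    the norm is at most |c| |b|. *)
Lemma completion_norm_theta z : completion_norm normK (theta z) <= normL z.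
Proof.
apply: (rep_norm_mor (kahler_t_gen (phi := iota \o phi)) (f := theta)).
- exact: completion_norm0.
- exact: completion_normD.
move=> [c b] /=; rewrite linearZ /= theta_d.
rewrite [leLHS](completion_norm_dense_scale c (dense_d b)).
by rewrite ler_wpM2l ?v_ge0 // completion_norm_dense_d.
Qed.

(** |x| = |theta (kappa x)| <= |kappa x| <= |x|, the canonical map to the completion being
    isometric. *)
Lemma kahler_map_isometry x : normL (kappa x) = normK x.
Proof.
apply/eqP; rewrite eq_le; apply/andP; split; first exact: kahler_map_le.
rewrite -completion_norm_to_completion -theta_kappa.
exact: completion_norm_theta.
Qed.

(** * Density of the elements m (x) 1 and of the images of kappa and psi; isometry of psi *)

(** If [c] in K is close to [a], then m (x) a is close to m (x) iota c = (c m) (x) 1. *)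
Lemma tensor_dense z (e : R) : 0 < e ->
  exists m, normT (z - tensor iota m 1) < e.
Proof.
move=> e0; have [s ->] := tensor_span z.
elim: s => [|[m a] s [m' IH]].
  exists 0; rewrite big_nil; have -> : tensor iota (0 : kahler phi) 1 = 0.
    by apply: (addrI (tensor iota 0 1)); rewrite addr0 -tensorDl addr0.
  by rewrite subr0 sn0.
(* Adding 1 keeps the denominator nonzero when [m] has seminorm 0. *)
have pm1 : 0 < normK m + 1 by rewrite ltr_wpDl ?sn_ge0.
have [c hc] := iota_dense a (divr_gt0 e0 pm1).
exists (c *: m + m'); rewrite big_cons tensorDl opprD addrACA.
rewrite (le_lt_trans (snD _ _ _)) // gt_max IH andbT tensorK mulr1 /=.
have -> : tensor iota m a - tensor iota m (iota c) = tensor iota m (a - iota c).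
  by apply/eqP; rewrite subr_eq -tensorDr subrK.
have := rep_norm_le (fun q => tensor iota q.1 q.2)
  (tensor_w_ge0 vL normK) [:: (m, a - iota c)].
rewrite big_seq1 big_cons big_nil max_l ?mulr_ge0 ?v_ge0 ?sn_ge0 //=.
move=> /le_lt_trans -> //; rewrite ltr_pdivlMr // in hc.
by rewrite (le_lt_trans _ hc) // mulrC ler_wpM2l ?v_ge0 // lerDl.
Qed.

Lemma kahler_map_dense y (e : R) : 0 < e -> exists x, normL (y - kappa x) < e.
Proof.
move=> e0; have [s ->] := presmod_span y.
elim: s => [|[c b] s [x' IH]].
  by exists 0; rewrite big_nil raddf0 subr0 sn0.
(* The error splits as (c - c') d(b) + c' d(b - b'), so [c'] is chosen first, and the tolerance for
   [b'] then depends on |c'|. *)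
have b1 : 0 < vL b + 1 by rewrite ltr_wpDl ?v_ge0.
have [c' hc] := iota_dense c (divr_gt0 e0 b1).
have c1 : 0 < vK c' + 1 by rewrite ltr_wpDl ?v_ge0.
have [b' hb] := iota_dense b (divr_gt0 e0 c1).
exists (c' *: dK b' + x'); rewrite big_cons.
have -> : kappa (c' *: dK b' + x') = iota c' *: dL (iota b') + kappa x'.
  by rewrite raddfD /= linearZ_LR /= kahler_map_d.
rewrite opprD addrACA (le_lt_trans (snD _ _ _)) // gt_max IH andbT.
rewrite -[gen _ _]/(dL b) -[(c, b).1]/c.
have -> : c *: dL b - iota c' *: dL (iota b') =
    (c - iota c') *: dL b + iota c' *: dL (b - iota b').
  by rewrite scalerBl kahler_dB scalerBr addrA subrK.
rewrite (le_lt_trans (snD _ _ _)) // gt_max !snZ iota_ext.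
rewrite !(le_lt_trans (ler_wpM2l (v_ge0 _ _) (kahler_seminorm_d _ _ _))) //.
  rewrite ltr_pdivlMr // in hb; rewrite (le_lt_trans _ hb) // mulrC.
  by rewrite ler_wpM2l ?v_ge0 // lerDl.
rewrite ltr_pdivlMr // in hc; rewrite (le_lt_trans _ hc) //.
by rewrite ler_wpM2l ?v_ge0 // lerDl.
Qed.

Lemma tensor_le m : normT (tensor iota m 1) <= normK m.
Proof.
have := rep_norm_le (fun q => tensor iota q.1 q.2)
  (tensor_w_ge0 vL normK) [:: (m, 1)].
by rewrite big_seq1 big_cons big_nil v1 mulr1 max_l ?sn_ge0.
Qed.

Lemma psi_tensor1 m : psi phi iota (tensor iota m 1) = kappa m.
Proof. by rewrite psi_tensor scale1r. Qed.

(* For m (x) 1 close to z: |z| ~ |m (x) 1| <= |m| = |kappa m| ~ |psi z|. *)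
Lemma psi_isometry z : normL (psi phi iota z) = normT z.
Proof.
apply/eqP; rewrite eq_le; apply/andP; split; first exact: psi_le.
apply/ler_addgt0Pr => e e0; have [m hm] := tensor_dense z e0.
have zm_e : normT (z - tensor iota m 1) <= normL (psi phi iota z) + e.
  by rewrite (le_trans (ltW hm)) // lerDr sn_ge0.
rewrite -[in leLHS](subrK (tensor iota m 1) z) (le_trans (snD _ _ _)) //.
rewrite ge_max zm_e (le_trans (tensor_le m)) // -kahler_map_isometry.
rewrite -psi_tensor1 -[tensor iota m 1](subKr z) raddfB.
rewrite (le_trans (snD _ _ _)) // snN ge_max lerDl ltW //=.
exact: le_trans (psi_le _ iota_ext _) zm_e.
Qed.

Lemma psi_dense y (e : R) : 0 < e -> exists z, normL (y - psi phi iota z) < e.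
Proof.
move=> /(kahler_map_dense y)[m hm]; exists (tensor iota m 1).
by rewrite psi_tensor1.
Qed.

End DenseKahler.

Theorem corollary5p6p7 (R : realType) (K L : fieldType)
    (vK : valuation R K) (vL : valuation R L) (iota : {rmorphism K -> L})
    (iota_ext : forall x : K, vL (iota x) = vK x)
    (iota_dense : forall (y : L) (e : R), 0 < e ->
      exists x : K, vL (y - iota x) < e)
    (A : comPzRingType) (phi : {rmorphism A -> K}) :
  isometric_isomorphism
    (completion_norm (tensor_seminorm iota vL (kahler_seminorm vK phi)))
    (completion_norm (kahler_seminorm vL (iota \o phi)))
    *:%R
    (completed_map (psi phi iota) (psi_le phi iota_ext))
  /\
  isometric_isomorphism
    (completion_norm (kahler_seminorm vK phi))
    (completion_norm (kahler_seminorm vL (iota \o phi)))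
    (iota \; *:%R)
    (completed_map (kahler_map phi iota) (kahler_map_le phi iota_ext)).
Proof.
split.
  apply: (completed_map_isometric_isomorphism (j := idfun)) => //.
  - by move=> a x; rewrite [LHS](linearZ_LR (psi phi iota)).
  - exact: psi_isometry.
  - exact: psi_dense.
apply: completed_map_isometric_isomorphism.
- by move=> a x; rewrite [LHS](linearZ_LR (kahler_map phi iota)).
- exact: kahler_map_isometry.
- exact: kahler_map_dense.
Qed.
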